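(* Suppose that the nonnegative matrix $A\in\mathbb{R}^{n\times n}$ has total support, and let $(\zeta_k)_{k\ge1}$ be generated by the LB (logarithmic barrier) iteration for $A$ with step sizes $\alpha_k$ chosen by backtracking line search with safeguard, started from a positive vector $\zeta_1\in\mathbb{R}^{2n}$. Then for all $k$ sufficiently large, the step size $\alpha_k$ in the LB iteration is $1$.
   Context: Total support: a nonnegative $n\times n$ matrix $A$ has total support if $A\ne0$ and for every positive entry $A_{i,j}$ there is a permutation $\sigma$ of $\{1,\dots,n\}$ with $\sigma(i)=j$ and $A_{l,\sigma(l)}>0$ for all $l$. Notation: $\mathbf 1_{m}$ is the all-ones vector, $\odot$ the entrywise product, $\log$ and powers of vectors are entrywise, $X^\dagger$ is the Moore–Penrose pseudoinverse. Put $\widetilde A=\begin{pmatrix} 0 & A \\ {A}^\top & 0 \end{pmatrix}\in\mathbb{R}^{2n\times2n}$ and, for positive $\zeta\in\mathbb{R}^{2n}$, $$\mathbf g(\zeta)=\tfrac12\zeta^\top\widetilde A\zeta-\mathbf 1_{2n}^\top\log\zeta,\qquad \nabla\mathbf g(\zeta)=\widetilde A\zeta-\zeta^{-1}.$$ LB iteration: given positive $\zeta_k$, let $B_k=\mathrm{diag}(\zeta_k)\widetilde A\,\mathrm{diag}(\zeta_k)$, $C_k=\mathrm{diag}(B_k\mathbf 1_{2n})$, $y_k=(C_k+B_k)^\dagger(B_k-I_{2n})\mathbf 1_{2n}$, $u_k=-\zeta_k\odot y_k$, and $$\zeta_{k+1}=\zeta_k+\alpha_ku_k=\zeta_k\odot(\mathbf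 1_{2n}-\alpha_ky_k).$$ Step size rule: fix a safeguard parameter $\epsilon_+\in(0,1)$, a backtracking parameter $\beta\in(0,1/2)$ and a reduction factor $\tau\in(0,1)$. The step size $\alpha_k$ is the first element of $1,\tau,\tau^2,\dots$ satisfying both (i) $\alpha\le y_{\max}^{-1}(1-\epsilon_+)$, where $y_{\max}$ is the largest positive entry of $y_k$ (no constraint if $y_k$ has no positive entry), which guarantees $\zeta_{k+1}\ge\epsilon_+\zeta_k>0$, and (ii) the sufficient decrease condition $\mathbf g(\zeta_k+\alpha u_k)\le\mathbf g(\zeta_k)+\beta\alpha\,\nabla\mathbf g(\zeta_k)^\top u_k$. *)

(* Defs.v *)
From HB Require Import structures.
From mathcomp Require Import all_boot all_order all_algebra perm.
From mathcomp Require Import all_classical all_reals all_analysis.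

Set Implicit Arguments.
Unset Strict Implicit.
Unset Printing Implicit Defensive.

Import Order.TTheory GRing.Theory Num.Theory.

Local Open Scope classical_set_scope.
Local Open Scope ring_scope.

Definition nonneg_mx (R : realType) (m n : nat) (A : 'M[R]_(m, n)) : Prop :=
  forall i j, 0 <= A i j.

Definition pos_vec (R : realType) (m : nat) (v : 'cV[R]_m) : Prop :=
  forall i, 0 < v i 0.

Definition total_support (R : realType) (n : nat) (A : 'M[R]_n) : Prop :=
  A != 0 /\
  forall i j, 0 < A i j ->
    exists s : 'S_n, s i = j /\ forall l, 0 < A l (s l).

Definition ones (R : realType) (m : nat) : 'cV[R]_m := const_mx 1.
Arguments ones {R m}.

Definition hadamard (R : realType) (m : nat) (u v : 'cV[R]_m) : 'cV[R]_m :=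
  map2_mx *%R u v.

Definition diagv (R : realType) (m : nat) (v : 'cV[R]_m) : 'M[R]_m :=
  diag_mx v^T.

(* The library's pinvmx is only a one-sided partial inverse on the row space,
   not the Moore-Penrose pseudoinverse. *)
Definition is_moore_penrose (R : realType) (m n : nat)
    (M : 'M[R]_(m, n)) (X : 'M[R]_(n, m)) : Prop :=
  [/\ M *m X *m M = M, X *m M *m X = X,
      (M *m X)^T = M *m X & (X *m M)^T = X *m M].

Definition moore_penrose (R : realType) (m n : nat) (M : 'M[R]_(m, n)) :
    'M[R]_(n, m) :=
  xget 0 [set X | is_moore_penrose M X].

Lemma moore_penrose_uniq (R : realType) (m n : nat) (M : 'M[R]_(m, n))
    (X Y : 'M[R]_(n, m)) :
  is_moore_penrose M X -> is_moore_penrose M Y -> X = Y.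
Proof.
move=> [X1 X2 X3 X4] [Y1 Y2 Y3 Y4].
have MXY : M *m X = M *m Y.
  rewrite -X3 -{1}Y1 -(mulmxA _ M X) trmx_mul X3 Y3.
  by rewrite mulmxA X1.
have XMY : X *m M = Y *m M.
  rewrite -X4 -{1}Y1 -(mulmxA M) mulmxA trmx_mul X4 Y4.
  by rewrite -mulmxA (mulmxA M X M) X1.
by rewrite -X2 -mulmxA MXY mulmxA XMY Y2.
Qed.

Lemma row_free_gram_unit (R : realType) (m n : nat) (D : 'M[R]_(m, n)) :
  row_free D -> D *m D^T \in unitmx.
Proof.
move=> Dfree; rewrite -row_free_unit -kermx_eq0.
apply/rowV0P => v /sub_kermxP vDD.
have vD0 : v *m D = 0.
  have : (v *m D) *m (v *m D)^T = 0.
    by rewrite trmx_mul mulmxA -(mulmxA v) vDD mul0mx.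
  move: (v *m D) => w /matrixP/(_ 0 0); rewrite mxE [RHS]mxE => w0.
  have wwE j : w 0 j * w^T j 0 = w 0 j ^+ 2 by rewrite mxE expr2.
  move: w0; under eq_bigr do rewrite wwE.
  move=> /psumr_eq0P w0; apply/matrixP => i j; rewrite ord1 [RHS]mxE.
  by apply/eqP; rewrite -sqrf_eq0 w0// => k _; exact: sqr_ge0.
by apply: (row_free_inj Dfree); rewrite vD0 mul0mx.
Qed.

Lemma is_moore_penrose_mul (R : realType) (m n r : nat)
    (C : 'M[R]_(m, r)) (D : 'M[R]_(r, n)) :
  C^T *m C \in unitmx -> D *m D^T \in unitmx ->
  is_moore_penrose (C *m D)
    (D^T *m invmx (D *m D^T) *m invmx (C^T *m C) *m C^T).
Proof.
move=> uC uD; set P := invmx (D *m D^T); set Q := invmx (C^T *m C).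
have PT : P^T = P by rewrite /P trmx_inv trmx_mul trmxK.
have QT : Q^T = Q by rewrite /Q trmx_inv trmx_mul trmxK.
set X := _ *m C^T.
have MX : C *m D *m X = C *m Q *m C^T.
  by rewrite /X !mulmxA -(mulmxA C D) -(mulmxA C (D *m D^T)) mulmxV ?mulmx1.
have XM : X *m (C *m D) = D^T *m P *m D.
  by rewrite /X !mulmxA -(mulmxA _ C^T C) -(mulmxA _ Q) mulVmx ?mulmx1.
split.
- by rewrite MX !mulmxA -(mulmxA _ C^T C) -(mulmxA C Q) mulVmx ?mulmx1.
- rewrite XM /X !mulmxA -(mulmxA _ D D^T) -(mulmxA D^T P (D *m D^T)).
  by rewrite mulVmx ?mulmx1.
- by rewrite MX !trmx_mul trmxK QT mulmxA.
- by rewrite XM !trmx_mul trmxK PT mulmxA.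
Qed.

Lemma moore_penrose_exists (R : realType) (m n : nat) (M : 'M[R]_(m, n)) :
  exists X, is_moore_penrose M X.
Proof.
rewrite -(mulmx_base M); eexists; apply: is_moore_penrose_mul.
  rewrite -{2}(trmxK (col_base M)); apply: row_free_gram_unit.
  by rewrite /row_free mxrank_tr; exact: col_base_full.
exact/row_free_gram_unit/row_base_free.
Qed.

Lemma moore_penroseP (R : realType) (m n : nat) (M : 'M[R]_(m, n)) :
  is_moore_penrose M (moore_penrose M).
Proof.
have [X MX] := moore_penrose_exists M.
by rewrite /moore_penrose; case: xgetP => // /(_ X).
Qed.

Section LB.
Variables (R : realType) (n : nat) (A : 'M[R]_n).
Implicit Type zeta : 'cV[R]_(n + n).

Definition Atilde : 'M[R]_(n + n) := block_mx 0 A A^T 0.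

Definition g zeta : R :=
  2^-1 * (zeta^T *m Atilde *m zeta) 0 0
  - ((ones : 'cV[R]_(n + n))^T *m map_mx (@ln R) zeta) 0 0.

Definition grad_g zeta : 'cV[R]_(n + n) :=
  Atilde *m zeta - map_mx GRing.inv zeta.

Definition LB_B zeta : 'M[R]_(n + n) :=
  diagv zeta *m Atilde *m diagv zeta.

Definition LB_C zeta : 'M[R]_(n + n) := diagv (LB_B zeta *m ones).

Definition LB_y zeta : 'cV[R]_(n + n) :=
  moore_penrose (LB_C zeta + LB_B zeta) *m (LB_B zeta - 1%:M) *m ones.

Definition LB_u zeta : 'cV[R]_(n + n) := - hadamard zeta (LB_y zeta).

(* The largest positive entry, or 0 when no entry is positive. *)
Definition ymax (m : nat) (y : 'cV[R]_m) : R :=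
  \big[Num.max/0]_(i < m) y i 0.

Definition step_ok (eps beta : R) zeta (a : R) : Prop :=
  (0 < ymax (LB_y zeta) -> a <= (ymax (LB_y zeta))^-1 * (1 - eps)) /\
  g (zeta + a *: LB_u zeta)
    <= g zeta + beta * a * ((grad_g zeta)^T *m LB_u zeta) 0 0.

Definition backtracking_step (eps beta tau : R) zeta (a : R) : Prop :=
  exists m : nat,
    [/\ a = tau ^+ m, step_ok eps beta zeta (tau ^+ m)
      & forall j, (j < m)%N -> ~ step_ok eps beta zeta (tau ^+ j)].

(* The sequences are indexed from 1; their values at 0 are irrelevant. *)
Definition LB_iteration (eps beta tau : R)
    (zeta : nat -> 'cV[R]_(n + n)) (alpha : nat -> R) : Prop :=
  forall k, (1 <= k)%N ->
    backtracking_step eps beta tau (zeta k) (alpha k) /\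
    zeta k.+1 = zeta k + alpha k *: LB_u (zeta k).

End LB.

(* Main.v *)
(* With B = diag(z) Atilde diag(z) and b = B 1, the direction y solves
   (diag(b) + B) y = b - 1: total support makes b - 1 orthogonal to the kernel.
   Put q = y^T (diag(b) + B) y = y^T (b - 1).  Since
   - ln (1 - t) <= t + t^2 / 2 + |t|^3 for |t| <= 1/2,
     g(z + a u) - g(z) <= (a^2/2 - a) q + (a^2/2 max|b - 1| + a^3 max|y|) |y|^2.
   On a sublevel set of g, t - ln t >= 1 applied along positive permutations
   bounds the entries of B above, and below by a positive multiple of those of
   Atilde; as y is orthogonal to the kernel, which does not depend on z, this
   gives |y|^2 <= c q and |b - 1| = O(|y|) uniformly.  Hence all small steps are
   accepted, so the accepted steps are bounded below; as g is bounded below, q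
   tends to 0; and once q is small the step 1 is accepted because beta < 1/2. *)
Require Import Defs.
From mathcomp Require Import all_boot all_order all_algebra.
From mathcomp Require Import all_classical all_reals all_analysis.
From mathcomp Require Import perm ring lra.
Import Order.TTheory GRing.Theory Num.Theory.
Import numFieldNormedType.Exports.
Set Implicit Arguments.
Unset Strict Implicit.
Local Open Scope classical_set_scope.
Local Open Scope ring_scope.

(** * Third-order bound for the logarithm *)

(** The coefficient [c] is left free because the cubic term |x|^3 is [c * x ^+ 3] with [c] = 1 to
    the right of 0 and [c] = -1 to the left. *)
Lemma is_derive_ln_taylor3 (R : realType) (c t : R) : t < 1 ->
  is_derive t (1 : R) (fun x : R => x + x ^+ 2 / 2 + c * x ^+ 3 + ln (1 - x))
    (1 + t + 3 * c * t ^+ 2 - (1 - t)^-1).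
Proof.
move=> t1.
have dln : is_derive (1 - t) (1 : R) (@ln R) (1 - t)^-1.
  by apply: is_derive1_ln; rewrite subr_gt0.
have dsub : is_derive t (1 : R) (fun x : R => 1 - x) (- 1).
  rewrite (_ : (fun x : R => 1 - x) = cst 1 - id) //.
  by apply: is_derive_eq; rewrite sub0r.
have dc : is_derive t (1 : R) (@ln R \o (fun x : R => 1 - x)) ((1 - t)^-1 * - 1).
  exact: (is_derive1_comp (f := @ln R) (g := fun x : R => 1 - x)).
have dp := is_derive_poly ('X + 2^-1 *: 'X^2 + c *: 'X^3) t.
have dpc := is_deriveD dp dc.
rewrite (_ : (fun x : R => _) =
    horner ('X + 2^-1 *: 'X^2 + c *: 'X^3) + (@ln R \o (fun x : R => 1 - x))
    :> (R -> R)); last first.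
  by apply/funext => x; rewrite /= fctE !hornerE /=; ring.
apply: is_derive_eq.
rewrite !poly.derivE !hornerE /= mulrN1; lra.
Qed.

(** The function [f c] vanishes at 0 and has derivative x^2 (3c - 1/(1 - x)). With the sign of [c]
    matched to that of [t], and 1/(1 - x) <= 2 on the positive side, the mean value theorem gives
    [f c t] >= 0. *)
Lemma oppr_ln1B_le (R : realType) (t : R) : `|t| <= 2^-1 ->
  - ln (1 - t) <= t + t ^+ 2 / 2 + `|t| ^+ 3.
Proof.
rewrite ler_norml => /andP[tlo thi].
pose f (c : R) := fun x : R => x + x ^+ 2 / 2 + c * x ^+ 3 + ln (1 - x).
have f0 c : f c 0 = 0 by rewrite /f expr0n /= subr0 ln1; ring.
have dle1 (x : R) : x <= 2^-1 -> x < 1 by move=> ?; lra.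
have cont c (a b : R) : b <= 2^-1 -> {within `[a, b], continuous (f c)}.
  move=> b1; apply: derivable_within_continuous => x /[!in_itv]/= /andP[_ xb].
  by have [] := is_derive_ln_taylor3 c (dle1 x (le_trans xb b1)).
have der c (a b : R) : b <= 2^-1 -> forall x, x \in `]a, b[%R ->
    is_derive x 1 (f c) (1 + x + 3 * c * x ^+ 2 - (1 - x)^-1).
  move=> b1 x /[!in_itv]/= /andP[_ xb].
  by apply: is_derive_ln_taylor3; apply/dle1/ltW/(lt_le_trans xb b1).
have inv (x : R) : x < 1 -> (1 - x)^-1 = 1 + x + x ^+ 2 / (1 - x).
  by move=> x1; field; lra.
have [t0|t0|->] := ltgtP t 0.
- have hf : (0 : R) <= 2^-1 by lra.
  have [c] := MVT t0 (der (-1) t 0 hf) (cont (-1) t 0 hf).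
  rewrite in_itv/= => /andP[tc c0]; rewrite f0 /f inv; last lra.
  have I0 : 0 < (1 - c)^-1 by rewrite invr_gt0; lra.
  have : 0 <= c ^+ 2 * (3 + (1 - c)^-1) * - t.
    by apply: mulr_ge0; [apply: mulr_ge0; [exact: sqr_ge0|lra]|lra].
  rewrite ltr0_norm //; lra.
- have [c] := MVT t0 (der 1 0 t thi) (cont 1 0 t thi).
  rewrite in_itv/= => /andP[c0 ct]; rewrite f0 /f inv; last lra.
  have I2 : (1 - c)^-1 <= 2 by rewrite -div1r ler_pdivrMr; lra.
  have : 0 <= c ^+ 2 * (3 - (1 - c)^-1) * t.
    by apply: mulr_ge0; [apply: mulr_ge0; [exact: sqr_ge0|lra]|lra].
  rewrite gtr0_norm //; lra.
- by rewrite normr0 subr0 ln1; lra.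
Qed.

(** * Pseudoinverses and signless Laplacians *)

Lemma mp_mulmx_ker_ortho (R : realType) (N : nat) (M : 'M[R]_N) (v : 'cV[R]_N) :
  M^T = M -> (forall x : 'cV[R]_N, M *m x = 0 -> v^T *m x = 0) ->
  M *m moore_penrose M *m v = v /\ moore_penrose M *m M *m v = v.
Proof.
move=> Msym vker.
have [MXM _ MXT XMT] := moore_penroseP M; set X := moore_penrose M in MXM MXT XMT *.
(* The columns of 1 - P lie in the kernel of [M], hence are orthogonal to [v]. This is applied to
   both projections, [M *m X] and [X *m M]. *)
have fixed (P : 'M[R]_N) : P^T = P -> M *m (1%:M - P) = 0 -> P *m v = v.
  move=> PT MP; suff v0 : v^T *m (1%:M - P) = 0.
    apply/esym/eqP; rewrite -subr_eq0 -{1}(mul1mx v) -mulmxBl -(trmxK (_ *m v)).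
    by rewrite trmx_mul linearB /= PT trmx1 v0 trmx0.
  apply/matrixP => i j.
  have -> : (v^T *m (1%:M - P)) i j = (v^T *m col j (1%:M - P)) i 0.
    by rewrite !colE mulmxA -colE [RHS]mxE.
  by rewrite vker ?mxE // colE mulmxA MP mul0mx.
split; apply: fixed => //.
  have := congr1 trmx MXM; rewrite !trmx_mul Msym mulmxA => MXTM.
  by rewrite mulmxBr mulmx1 -MXT trmx_mul Msym mulmxA MXTM subrr.
by rewrite mulmxBr mulmx1 mulmxA MXM subrr.
Qed.

(** At [LB_B A z] this is the matrix [LB_C A z + LB_B A z] of the LB system; at [Atilde A] it serves
    as a reference matrix independent of [z]. *)
Definition signless_laplacian (R : realType) (N : nat) (B : 'M[R]_N) : 'M[R]_N :=
  diagv (B *m ones) + B.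

Lemma signless_laplacian_mulmxE (R : realType) (N : nat) (B : 'M[R]_N) (x : 'cV[R]_N) i :
  (signless_laplacian B *m x) i 0 = \sum_j B i j * (x i 0 + x j 0).
Proof.
rewrite mulmxDl mxE mul_diag_mx !mxE mulr_suml -big_split /=.
by apply: eq_bigr => j _; rewrite !mxE mulr1 mulrDr.
Qed.

Lemma signless_laplacian_sym (R : realType) (N : nat) (B : 'M[R]_N) :
  B^T = B -> (signless_laplacian B)^T = signless_laplacian B.
Proof. by move=> BT; rewrite linearD /= tr_diag_mx BT. Qed.

(** By symmetry the outer factor x i may be exchanged for x j; averaging the two forms produces the
    square. *)
Lemma signless_laplacian_quad (R : realType) (N : nat) (B : 'M[R]_N) (x : 'I_N -> R) :
  B^T = B ->
  \sum_i x i * (\sum_j B i j * (x i + x j)) =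
  2^-1 * \sum_i \sum_j B i j * (x i + x j) ^+ 2.
Proof.
move=> BT; set s := LHS.
have sE : s = \sum_i \sum_j B i j * x i * (x i + x j).
  by apply: eq_bigr => i _; rewrite mulr_sumr; apply: eq_bigr => j _; ring.
have sE' : s = \sum_i \sum_j B i j * x j * (x i + x j).
  rewrite sE exchange_big; apply: eq_bigr => i _; apply: eq_bigr => j _ /=.
  by rewrite -{1}BT mxE addrC.
have -> : \sum_i \sum_j B i j * (x i + x j) ^+ 2 = s + s.
  rewrite {1}sE sE' -big_split; apply: eq_bigr => i _ /=.
  by rewrite -big_split; apply: eq_bigr => j _ /=; ring.
by rewrite -mulr2n -[s *+ 2]mulr_natl mulrA mulVf ?mul1r.
Qed.

Lemma signless_laplacian_edge_le (R : realType) (N : nat) (B : 'M[R]_N) (x : 'I_N -> R) i j :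
  B^T = B -> nonneg_mx B ->
  B i j * (x i + x j) ^+ 2 <= 2 * \sum_i x i * (\sum_j B i j * (x i + x j)).
Proof.
move=> BT B0; rewrite signless_laplacian_quad // mulVKf //.
have ge0 k l : 0 <= B k l * (x k + x l) ^+ 2 by rewrite mulr_ge0 ?sqr_ge0 ?B0.
rewrite (bigD1 i) //= (bigD1 j) //= -addrA lerDl addr_ge0 ?sumr_ge0 // => k _.
by rewrite sumr_ge0.
Qed.

(** The quadratic form vanishes at [x], so each of its nonnegative edge terms does. Kernel vectors
    are thus those that change sign along every edge, a condition on the zero pattern of [B]
    only. *)
Lemma signless_laplacian_ker (R : realType) (N : nat) (B : 'M[R]_N) (x : 'cV[R]_N) :
  B^T = B -> nonneg_mx B -> signless_laplacian B *m x = 0 ->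
  forall i j, B i j * (x i 0 + x j 0) = 0.
Proof.
move=> BT B0 Bx i j.
have := signless_laplacian_edge_le (fun k => x k 0) i j BT B0.
rewrite big1 => [|k _]; last by rewrite -signless_laplacian_mulmxE Bx mxE mulr0.
rewrite mulr0 => le0.
have /eqP : B i j * (x i 0 + x j 0) ^+ 2 = 0.
  by apply/eqP; rewrite eq_le le0 mulr_ge0 ?sqr_ge0 ?B0.
by rewrite mulf_eq0 sqrf_eq0 -mulf_eq0 => /eqP.
Qed.

(** Orthogonality to the kernel gives y = X L y with X the pseudoinverse of L, so a bound on L y,
    which only involves the edge sums y i + y j, bounds y itself. *)
Lemma signless_laplacian_coercive (R : realType) (N : nat) (S : 'M[R]_N) :
  S^T = S -> nonneg_mx S ->
  exists2 c : R, 0 < c & forall (y : 'cV[R]_N) (p : R),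
    (forall x : 'cV[R]_N, signless_laplacian S *m x = 0 -> y^T *m x = 0) ->
    (forall i j, S i j * (y i 0 + y j 0) ^+ 2 <= p) ->
    forall i, y i 0 ^+ 2 <= c * p.
Proof.
move=> ST S0; set L := signless_laplacian S; pose X := moore_penrose L.
pose s := \sum_i \sum_j S i j; pose T := \sum_i \sum_j `|X i j|.
have s_ge i j : S i j <= s.
  rewrite /s (bigD1 i) //= (bigD1 j) //= -addrA lerDl addr_ge0 ?sumr_ge0 //.
  by move=> k _; rewrite sumr_ge0.
have T_ge i : \sum_j `|X i j| <= T.
  by rewrite /T [leRHS](bigD1 i) //= lerDl sumr_ge0 // => k _; rewrite sumr_ge0.
have s0 : 0 <= s by rewrite sumr_ge0 // => i _; rewrite sumr_ge0.
have T0 : 0 <= T by rewrite sumr_ge0 // => i _; rewrite sumr_ge0.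
(* From |y i| <= T N sqrt(s p); the added 1 makes the constant positive. *)
exists (T ^+ 2 * N%:R ^+ 2 * s + 1).
  by rewrite ltr_wpDl // !mulr_ge0 ?sqr_ge0 // ?exprn_ge0.
move=> y p yker yp i.
have p0 : 0 <= p by apply: le_trans (yp i i); rewrite mulr_ge0 ?sqr_ge0 ?S0.
have [_ yE] := mp_mulmx_ker_ortho (signless_laplacian_sym ST) yker.
set h := Num.sqrt (s * p).
have h0 : 0 <= h by rewrite sqrtr_ge0.
(* Each summand has square S (S (y k + y j)^2) <= s p. *)
have w_le k : `|(L *m y) k 0| <= N%:R * h.
  rewrite signless_laplacian_mulmxE (le_trans (ler_norm_sum _ _ _)) //.
  rewrite mulr_natl -[X in _ *+ X]card_ord -sumr_const; apply: ler_sum => j _.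
  rewrite -[leLHS]ger0_norm // -sqrtr_sqr ler_wsqrtr // real_normK ?num_real //.
  rewrite exprMn expr2 -mulrA; apply: ler_pM => //.
  by rewrite mulr_ge0 ?sqr_ge0.
have y_le : `|y i 0| <= T * (N%:R * h).
  rewrite -yE -mulmxA mxE (le_trans (ler_norm_sum _ _ _)) //.
  rewrite (@le_trans _ _ ((\sum_j `|X i j|) * (N%:R * h))) //.
    by rewrite mulr_suml ler_sum // => j _; rewrite normrM ler_wpM2l.
  by rewrite ler_wpM2r // mulr_ge0.
rewrite -[leLHS]real_normK ?num_real //.
apply: (@le_trans _ _ ((T * (N%:R * h)) ^+ 2)).
  by rewrite lerXn2r ?nnegrE ?mulr_ge0.
rewrite !exprMn sqr_sqrtr ?mulr_ge0 // mulrDl mul1r !mulrA lerDl //.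
Qed.

(** * Entrywise formulas and the linear system for the LB direction *)

Lemma Atilde_sym (R : realType) (n : nat) (A : 'M[R]_n) : (Atilde A)^T = Atilde A.
Proof. by rewrite /Atilde tr_block_mx !trmx0 trmxK. Qed.

Lemma Atilde_ge0 (R : realType) (n : nat) (A : 'M[R]_n) :
  nonneg_mx A -> nonneg_mx (Atilde A).
Proof.
move=> A0 i j; case: (split_ordP i) => {}i ->; case: (split_ordP j) => {}j ->;
  rewrite ?block_mxEul ?block_mxEur ?block_mxEdl ?block_mxEdr ?[X in _ <= X]mxE //=; exact: A0.
Qed.

Lemma LB_BE (R : realType) (n : nat) (A : 'M[R]_n) (z : 'cV[R]_(n + n)) i j :
  LB_B A z i j = z i 0 * Atilde A i j * z j 0.
Proof. by rewrite /LB_B /diagv mul_mx_diag mxE mul_diag_mx !mxE. Qed.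

Lemma LB_B_sym (R : realType) (n : nat) (A : 'M[R]_n) (z : 'cV[R]_(n + n)) :
  (LB_B A z)^T = LB_B A z.
Proof.
apply/matrixP => i j; rewrite [LHS]mxE !LB_BE.
by have /matrixP/(_ i j) := Atilde_sym A; rewrite mxE => ->; ring.
Qed.

Lemma LB_B_ge0 (R : realType) (n : nat) (A : 'M[R]_n) (z : 'cV[R]_(n + n)) :
  nonneg_mx A -> pos_vec z -> nonneg_mx (LB_B A z).
Proof.
move=> A0 z0 i j; rewrite LB_BE mulr_ge0 ?(ltW (z0 _)) // mulr_ge0 ?(ltW (z0 _)) //.
exact: Atilde_ge0.
Qed.

Lemma gE (R : realType) (n : nat) (A : 'M[R]_n) (z : 'cV[R]_(n + n)) :
  g A z = 2^-1 * \sum_i \sum_j LB_B A z i j - \sum_i ln (z i 0).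
Proof.
congr (_ * _ - _).
  rewrite mxE exchange_big; apply: eq_bigr => j _ /=.
  by rewrite mxE mulr_suml; apply: eq_bigr => i _; rewrite LB_BE !mxE.
by rewrite mxE; apply: eq_bigr => i _; rewrite !mxE mul1r.
Qed.

Lemma total_support_perm (R : realType) (n : nat) (A : 'M[R]_n) :
  nonneg_mx A -> total_support A -> exists s : 'S_n, forall i, 0 < A i (s i).
Proof.
move=> A0 [Aneq0 As].
suff [i [j Aij]] : exists i j, 0 < A i j by have [s [_ ?]] := As _ _ Aij; exists s.
apply: contrapT => Anpos; move/eqP: Aneq0; apply; apply/matrixP => i j.
rewrite mxE; apply: contrapT => /eqP Aij; apply: Anpos; exists i, j.
by rewrite lt_def Aij A0.
Qed.

(** Regroups the 2n indices along the perfect matching that [s] defines between rows and columns. *)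
Lemma sum_double_perm (R : realType) (n : nat) (s : 'S_n) (F : 'I_(n + n) -> R) :
  \sum_i F i = \sum_i (F (lshift n i) + F (rshift n (s i))).
Proof.
rewrite big_split_ord big_split /=; congr (_ + _).
by rewrite (reindex_inj (@perm_inj _ s)).
Qed.

(** The right-hand side b - 1 is orthogonal to the kernel, so the pseudoinverse solves the system
    exactly. Orthogonality of y is stated for the kernel at [Atilde A], so that one coercivity
    constant serves every [z]. *)
Lemma LB_y_spec (R : realType) (n : nat) (A : 'M[R]_n) (z : 'cV[R]_(n + n)) :
  nonneg_mx A -> total_support A -> pos_vec z ->
  (forall i, \sum_j LB_B A z i j * (LB_y A z i 0 + LB_y A z j 0) =
             \sum_j LB_B A z i j - 1) /\
  (forall x : 'cV[R]_(n + n),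
     signless_laplacian (Atilde A) *m x = 0 -> (LB_y A z)^T *m x = 0).
Proof.
move=> A0 Ats z0; set B := LB_B A z; set y := LB_y A z.
have [BT B0] := (LB_B_sym A z, LB_B_ge0 A0 z0).
have BC i j : B i j = B j i by have /matrixP/(_ i j) := BT; rewrite mxE.
pose v := (B - 1%:M) *m ones : 'cV_(n + n).
have vE i : v i 0 = \sum_j B i j - 1.
  rewrite /v mulmxBl mul1mx mxE [X in _ + X]mxE [X in X + _]mxE [X in _ - X]mxE; congr (_ - _).
  by apply: eq_bigr => j _; rewrite [ones _ _]mxE mulr1.
have yE : y = moore_penrose (signless_laplacian B) *m v by rewrite /v mulmxA.
have Bedge (x : 'cV_(n + n)) : signless_laplacian B *m x = 0 ->
    forall i j, B i j * (x i 0 + x j 0) = 0.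
  by move=> Bx; exact: signless_laplacian_ker.
have vker (x : 'cV_(n + n)) : signless_laplacian B *m x = 0 -> v^T *m x = 0.
  move=> Bx; have Be := Bedge x Bx.
  apply/matrixP => i j; rewrite !ord1 [RHS]mxE mxE {i j}.
  under eq_bigr => i _ do rewrite mxE vE mulrBl mul1r.
  rewrite sumrB.
  (* A kernel vector takes opposite values at the two ends of each edge of a positive matching. *)
  have -> : \sum_i x i 0 = 0.
    have [s As] := total_support_perm A0 Ats.
    rewrite (sum_double_perm s) big1 // => i _.
    have /eqP := Be (lshift n i) (rshift n (s i)).
    by rewrite /B LB_BE block_mxEur mulf_eq0 gt_eqF ?mulr_gt0 //= => /eqP.
  suff : \sum_i (\sum_j B i j) * x i 0 + \sum_i (\sum_j B i j) * x i 0 = 0.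
    by rewrite subr0; lra.
  have {1}-> : \sum_i (\sum_j B i j) * x i 0 = \sum_i \sum_j B i j * x j 0.
    rewrite [RHS]exchange_big; apply: eq_bigr => i _ /=.
    by rewrite mulr_suml; apply: eq_bigr => j _; rewrite BC.
  rewrite -big_split big1 // => i _ /=; rewrite mulr_suml -big_split big1 // => j _ /=.
  by rewrite -mulrDr addrC Be.
have [vM _] := mp_mulmx_ker_ortho (signless_laplacian_sym BT) vker.
split=> [i|x Sx].
  by rewrite -signless_laplacian_mulmxE yE mulmxA vM vE.
(* [B] is an entrywise multiple of [Atilde A], so a sign change along the edges of the latter is one
   along the edges of [B]. *)
have Bx : signless_laplacian B *m x = 0.
  apply/matrixP => i j; rewrite ord1 signless_laplacian_mulmxE mxE big1 // => k _.
  have Se := signless_laplacian_ker (Atilde_sym A) (Atilde_ge0 A0) Sx i k.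
  transitivity (z i 0 * z k 0 * (Atilde A i k * (x i 0 + x k 0))).
    by rewrite /B LB_BE; ring.
  by rewrite Se mulr0.
have [_ XMX _ XMT] := moore_penroseP (signless_laplacian B).
have -> : y = moore_penrose (signless_laplacian B) *m signless_laplacian B *m y.
  by rewrite {2}yE mulmxA XMX -yE.
by rewrite trmx_mul XMT -!mulmxA Bx !mulmx0.
Qed.

(** * Change of [g] along an LB step *)

Lemma LB_stepE (R : realType) (n : nat) (A : 'M[R]_n) (z : 'cV[R]_(n + n)) (a : R) i :
  (z + a *: LB_u A z) i 0 = z i 0 * (1 - a * LB_y A z i 0).
Proof. by rewrite !mxE; ring. Qed.

Lemma grad_LB_u (R : realType) (n : nat) (A : 'M[R]_n) (z : 'cV[R]_(n + n)) :
  pos_vec z ->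
  ((grad_g A z)^T *m LB_u A z) 0 0 =
  - \sum_i LB_y A z i 0 * (\sum_j LB_B A z i j - 1).
Proof.
move=> z0; rewrite mxE -sumrN; apply: eq_bigr => i _; rewrite [X in X * _]mxE.
have -> : LB_u A z i 0 = - (z i 0 * LB_y A z i 0) by rewrite !mxE.
have -> : grad_g A z i 0 = (\sum_j Atilde A i j * z j 0) - (z i 0)^-1.
  by rewrite [LHS]mxE [X in X + _]mxE [X in _ + X]mxE [X in _ - X]mxE.
have -> : \sum_j LB_B A z i j = z i 0 * \sum_j Atilde A i j * z j 0.
  by rewrite mulr_sumr; apply: eq_bigr => j _; rewrite LB_BE mulrA.
by field; rewrite gt_eqF.
Qed.

(** The quadratic part of [g] is expanded exactly and only the logarithms are estimated. The
    second-order terms in b y^2 and y^2 combine to (b - 1) y^2, which is why [D] bounds b - 1 rather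
    than b. *)
Lemma g_step_le (R : realType) (n : nat) (A : 'M[R]_n) (z : 'cV[R]_(n + n)) (a r D : R) :
  pos_vec z ->
  (forall i, \sum_j LB_B A z i j * (LB_y A z i 0 + LB_y A z j 0) =
             \sum_j LB_B A z i j - 1) ->
  0 <= a -> a * r <= 2^-1 -> (forall i, `|LB_y A z i 0| <= r) ->
  (forall i, `|\sum_j LB_B A z i j - 1| <= D) ->
  g A (z + a *: LB_u A z) <= g A z
    + (a ^+ 2 / 2 - a) * (\sum_i LB_y A z i 0 * (\sum_j LB_B A z i j - 1))
    + (a ^+ 2 / 2 * D + a ^+ 3 * r) * \sum_i LB_y A z i 0 ^+ 2.
Proof.
move=> z0 yeq a0 ar yr bD.
pose y i : R := LB_y A z i 0; pose B := LB_B A z; pose b i := \sum_j B i j.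
rewrite -/B; under eq_bigr => i _ do rewrite -/(y i) -/(b i).
under [X in _ <= _ + _ + _ * X]eq_bigr => i _ do rewrite -/(y i).
have ay_le i : `|a * y i| <= 2^-1.
  by rewrite normrM (ger0_norm a0) (le_trans _ ar) // ler_wpM2l ?yr.
have ay1 i : 0 < 1 - a * y i.
  by have := ay_le i; rewrite ler_norml => /andP[_]; lra.
(* The linear system tested against y: y^T B y = q - sum of b y^2. *)
have yBy : \sum_i \sum_j B i j * (y i * y j) =
    \sum_i y i * (b i - 1) - \sum_i b i * y i ^+ 2.
  rewrite -sumrB; apply: eq_bigr => i _; rewrite /b -yeq mulr_sumr mulr_suml -sumrB.
  by apply: eq_bigr => j _; rewrite /y /B; ring.
have Bnew : \sum_i \sum_j LB_B A (z + a *: LB_u A z) i j =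
    \sum_i \sum_j B i j - 2 * a * (\sum_i b i * y i)
    + a ^+ 2 * \sum_i \sum_j B i j * (y i * y j).
  have by' : \sum_i b i * y i = \sum_i \sum_j B i j * y j.
    rewrite [RHS]exchange_big; apply: eq_bigr => i _; rewrite mulr_suml.
    apply: eq_bigr => j _.
    by have /matrixP/(_ i j) := LB_B_sym A z; rewrite mxE /B => ->.
  have -> : 2 * a * (\sum_i b i * y i) =
      a * (\sum_i b i * y i) + a * (\sum_i b i * y i) by ring.
  rewrite {2}by' !mulr_sumr opprD addrA -!sumrB -big_split; apply: eq_bigr => i _ /=.
  rewrite /b mulr_suml !mulr_sumr -!sumrB -big_split; apply: eq_bigr => j _ /=.
  by rewrite /B !LB_BE !LB_stepE -/(y i) -/(y j); ring.
have lnnew : - (\sum_i ln ((z + a *: LB_u A z) i 0)) <=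
    - (\sum_i ln (z i 0)) + (a * (\sum_i y i) + a ^+ 2 / 2 * (\sum_i y i ^+ 2) +
      a ^+ 3 * r * (\sum_i y i ^+ 2)).
  rewrite !mulr_sumr -!big_split -!sumrN -big_split ler_sum // => i _ /=.
  rewrite LB_stepE lnM ?posrE ?ay1 // opprD lerD2l.
  apply: le_trans (oppr_ln1B_le (ay_le i)) _; rewrite exprMn.
  have -> : `|a * y i| ^+ 3 = a ^+ 3 * `|y i| * y i ^+ 2.
    rewrite normrM (ger0_norm a0) -[y i ^+ 2]real_normK ?num_real //; ring.
  rewrite lerD //; first by rewrite lerD2l; lra.
  by rewrite ler_wpM2r ?sqr_ge0 // ler_wpM2l ?exprn_ge0 ?yr.
have by2 : - (\sum_i (b i - 1) * y i ^+ 2) <= D * \sum_i y i ^+ 2.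
  rewrite mulr_sumr -sumrN ler_sum // => i _.
  rewrite -mulNr ler_wpM2r ?sqr_ge0 //.
  by apply: le_trans (bD i); rewrite -normrN ler_norm.
have by2E : \sum_i (b i - 1) * y i ^+ 2 = \sum_i b i * y i ^+ 2 - \sum_i y i ^+ 2.
  by rewrite -sumrB; apply: eq_bigr => i _; ring.
have qE : \sum_i y i * (b i - 1) = \sum_i b i * y i - \sum_i y i.
  by rewrite -sumrB; apply: eq_bigr => i _; ring.
rewrite !gE Bnew yBy -/B.
have := ler_wpM2l (_ : 0 <= a ^+ 2 / 2) by2; rewrite by2E qE.
move=> /(_ (mulr_ge0 (sqr_ge0 _) _)); lra.
Qed.

(** * Bounds on the sublevel sets of [g] *)

Lemma ln_leB1 (R : realType) (x : R) : 0 < x -> ln x <= x - 1.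
Proof.
move=> x0; have {1}-> : x = 1 + (x - 1) by ring.
by apply: le_ln1Dx; lra.
Qed.

Lemma mulB_ln_ge (R : realType) (a s : R) : 0 < a -> 0 < s ->
  1 + ln a <= a * s - ln s.
Proof.
move=> a0 s0; have := ln_leB1 (mulr_gt0 a0 s0); rewrite lnM ?posrE //; lra.
Qed.

(** Half of the linear term is kept, so that an upper bound on [a * s] can be read off; ln x <= x -
    1 is used at x = a s / 2 together with ln 2 <= 1. *)
Lemma mulB_ln_ge_half (R : realType) (a s : R) : 0 < a -> 0 < s ->
  a * s / 2 - 1 + (1 + ln a) <= a * s - ln s.
Proof.
move=> a0 s0; have as0 : 0 < a * s / 2 by rewrite divr_gt0 ?mulr_gt0.
have := ln_leB1 as0; rewrite ln_div ?posrE ?mulr_gt0 // lnM ?posrE //.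
have := @ln_leB1 R 2 ltac:(lra); lra.
Qed.

(** Each matching edge occurs twice in the symmetric double sum, which cancels the factor 1/2; all
    other entries are nonnegative and are dropped. *)
Lemma g_perm_ge (R : realType) (n : nat) (A : 'M[R]_n) (z : 'cV[R]_(n + n)) (s : 'S_n) :
  nonneg_mx A -> pos_vec z ->
  \sum_i (A i (s i) * (z (lshift n i) 0 * z (rshift n (s i)) 0)
          - ln (z (lshift n i) 0 * z (rshift n (s i)) 0)) <= g A z.
Proof.
move=> A0 z0; rewrite gE !(sum_double_perm s) sumrB lerD //; last first.
  by rewrite lerN2 ler_sum // => i _; rewrite lnM ?posrE.
rewrite mulr_sumr ler_sum // => i _.
have le (k l : 'I_(n + n)) : LB_B A z k l <= \sum_j LB_B A z k j.
  rewrite (bigD1 l) //= lerDl sumr_ge0 // => j _; exact: LB_B_ge0.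
have := le (lshift n i) (rshift n (s i)); have := le (rshift n (s i)) (lshift n i).
rewrite !LB_BE block_mxEur block_mxEdl mxE; lra.
Qed.

Lemma sublevel_bounds (R : realType) (n : nat) (A : 'M[R]_n) :
  nonneg_mx A -> total_support A ->
  (exists lb : R, forall z, pos_vec z -> lb <= g A z) /\
  forall G : R, exists m M : R, [/\ 0 < m, 0 < M &
    forall z, pos_vec z -> g A z <= G ->
      forall i j, m * Atilde A i j <= LB_B A z i j <= M].
Proof.
move=> A0 Ats; pose K : R := \sum_i \sum_j `|1 + ln (A i j)|.
have K0 : 0 <= K by rewrite sumr_ge0 // => i _; rewrite sumr_ge0.
have le_K i j : `|1 + ln (A i j)| <= K.
  rewrite /K [leRHS](bigD1 i) //= (bigD1 j) //= -addrA lerDl addr_ge0 ?sumr_ge0 //.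
  by move=> k _; rewrite sumr_ge0.
pose h (z : 'cV[R]_(n + n)) (s : 'S_n) i : R :=
  A i (s i) * (z (lshift n i) 0 * z (rshift n (s i)) 0)
  - ln (z (lshift n i) 0 * z (rshift n (s i)) 0).
(* Arbitrary subsets [P] are allowed so that one edge can be isolated and the rest bounded below. *)
have h_ge (z : 'cV[R]_(n + n)) (s : 'S_n) (P : pred 'I_n) :
    pos_vec z -> (forall i, 0 < A i (s i)) ->
    - K <= \sum_(i | P i) h z s i.
  move=> z0 As.
  apply: (@le_trans _ _ (\sum_(i | P i) - (\sum_j `|1 + ln (A i j)|))).
    rewrite sumrN lerN2 /K [leRHS](bigID P) /= lerDl sumr_ge0 // => i _.
    by rewrite sumr_ge0.
  apply: ler_sum => i _; apply: le_trans (mulB_ln_ge (As i) _); last first.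
    by rewrite mulr_gt0.
  rewrite lerNl (bigD1 (s i)) //= (le_trans (y := `|1 + ln (A i (s i))|)) //.
    by rewrite -normrN ler_norm.
  by rewrite lerDl sumr_ge0.
split.
  have [s As] := total_support_perm A0 Ats.
  exists (- K) => z z0; apply: le_trans (g_perm_ge s A0 z0); exact: h_ge.
(* For a positive entry a = A i j and t = z i z j, isolating the edge gives a t - ln t <= G + K.
   Hence t >= exp(-(G + K)), and the half-linear bound gives a t <= 2 (G + 2K + 1). *)
move=> G; exists (expR (- (G + K))), (`|2 * (G + 2 * K + 1)| + 1).
have M0 : 0 < `|2 * (G + 2 * K + 1)| + 1 by rewrite ltr_wpDl.
split; rewrite ?expR_gt0 // => z z0 gz.
have edge i j : expR (- (G + K)) * A i j <= z (lshift n i) 0 * A i j * z (rshift n j) 0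
    <= `|2 * (G + 2 * K + 1)| + 1.
  have := A0 i j; rewrite le_eqVlt => /predU1P[<-|Aij].
    by rewrite !mulr0 mul0r lexx ltW.
  have [s [sij As]] := Ats.2 i j Aij.
  have := le_trans (g_perm_ge s A0 z0) gz; rewrite (bigD1 i) //= sij.
  have := h_ge z s (fun k => k != i) z0 As; rewrite /h.
  set rest := \sum_(_ | _) _ => rest_ge hG.
  set t := z (lshift n i) 0 * z (rshift n j) 0 in hG *.
  have t0 : 0 < t by rewrite mulr_gt0.
  have -> : z (lshift n i) 0 * A i j * z (rshift n j) 0 = A i j * t by rewrite /t; ring.
  have At0 : 0 <= A i j * t by rewrite mulr_ge0 // ltW.
  apply/andP; split.
    rewrite mulrC ler_wpM2l // -[leRHS]lnK ?posrE // ler_expR; lra.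
  have := mulB_ln_ge_half Aij t0; have := le_K i j; rewrite ler_norml => /andP[lo _].
  move=> h2; apply: (@le_trans _ _ (2 * (G + 2 * K + 1))); first lra.
  by rewrite (le_trans (ler_norm _)) // lerDl.
move=> i j; rewrite LB_BE.
case: (split_ordP i) => {}i ->; case: (split_ordP j) => {}j ->.
- by rewrite block_mxEul mxE !mulr0 mul0r lexx ltW.
- by rewrite block_mxEur.
- by rewrite block_mxEdl mxE mulrAC [X in _ <= X * _ <= _]mulrC mulrAC.
- by rewrite block_mxEdr mxE !mulr0 mul0r lexx ltW.
Qed.

(** * Acceptance of step sizes *)

Lemma ymax_ge (R : realType) (m : nat) (y : 'cV[R]_m) i : y i 0 <= ymax y.
Proof. exact: (le_bigmax _ (fun i => y i 0)). Qed.

Lemma step_ok_pos (R : realType) (n : nat) (A : 'M[R]_n) (eps beta a : R)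
    (z : 'cV[R]_(n + n)) :
  0 < eps < 1 -> 0 <= a -> pos_vec z -> step_ok A eps beta z a ->
  pos_vec (z + a *: LB_u A z).
Proof.
move=> /andP[eps0 eps1] a0 z0 [ok _] i; rewrite LB_stepE mulr_gt0 // subr_gt0.
have y_le := ymax_ge (LB_y A z) i.
(* If [ymax] is 0 the safeguard is void, but then every entry of y is at most 0. *)
have [ym|ym] := leP (ymax (LB_y A z)) 0.
  by rewrite (le_lt_trans _ ltr01) // mulr_ge0_le0 // (le_trans y_le).
apply: (@le_lt_trans _ _ (a * ymax (LB_y A z))); first by rewrite ler_wpM2l.
have := ok ym; rewrite mulrC ler_pdivlMr // => ?; lra.
Qed.

(** The first bound is coercivity, transferred from [Atilde A] to B through m Atilde <= B. The last
    two bound b - 1 absolutely, for small steps, and through b - 1 = (diag(b) + B) y in proportion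
    to y, for the unit step. *)
Lemma LB_uniform_estimates (R : realType) (n : nat) (A : 'M[R]_n) (G : R) :
  nonneg_mx A -> total_support A ->
  exists c M : R, [/\ 0 < c, 0 < M & forall z, pos_vec z -> g A z <= G ->
    [/\ \sum_i LB_y A z i 0 ^+ 2 <=
          c * \sum_i LB_y A z i 0 * (\sum_j LB_B A z i j - 1),
        forall i, `|\sum_j LB_B A z i j - 1| <= M
      & forall r, (forall i, `|LB_y A z i 0| <= r) ->
          forall i, `|\sum_j LB_B A z i j - 1| <= M * r]].
Proof.
move=> A0 Ats; have [_ /(_ G) [m [M [m0 M0 zB]]]] := sublevel_bounds A0 Ats.
have [c c0 cP] := signless_laplacian_coercive (Atilde_sym A) (Atilde_ge0 A0).
exists ((n + n)%:R * (c * (2 / m)) + 1), ((n + n)%:R * (2 * M) + 1).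
split; first by rewrite ltr_wpDl // !mulr_ge0 // ?invr_ge0 ltW.
  by rewrite ltr_wpDl // !mulr_ge0 // ltW.
move=> z z0 gz; have [yeq yker] := LB_y_spec A0 Ats z0.
have [BT B0] := (LB_B_sym A z, LB_B_ge0 A0 z0).
set y := LB_y A z in yeq yker *; set B := LB_B A z in yeq BT B0 *.
have {}zB i j : m * Atilde A i j <= B i j <= M by exact: zB.
have card_sum (t : R) : \sum_(i < n + n) t = (n + n)%:R * t.
  by rewrite sumr_const card_ord mulr_natl.
pose q := \sum_i y i 0 * (\sum_j B i j - 1).
have qE : q = \sum_i y i 0 * (\sum_j B i j * (y i 0 + y j 0)).
  by apply: eq_bigr => i _; rewrite yeq.
have edge i j : Atilde A i j * (y i 0 + y j 0) ^+ 2 <= 2 / m * q.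
  rewrite mulrAC ler_pdivlMr // mulrC mulrA.
  apply: (@le_trans _ _ (B i j * (y i 0 + y j 0) ^+ 2)).
    by rewrite ler_wpM2r ?sqr_ge0 //; case/andP: (zB i j).
  by rewrite qE (signless_laplacian_edge_le (fun i => y i 0)).
have y2 := cP y _ yker edge.
have q0 : 0 <= q.
  rewrite qE (signless_laplacian_quad (fun i => y i 0)) // mulr_ge0 //.
  by rewrite sumr_ge0 // => i _; rewrite sumr_ge0 // => j _; rewrite mulr_ge0 ?sqr_ge0.
split.
- rewrite -/q mulrDl mul1r -[leLHS]addr0 lerD //.
  rewrite -!mulrA -card_sum; apply: ler_sum => i _.
  by apply: le_trans (y2 i) _; rewrite !mulrA.
- move=> i; have b0 : 0 <= \sum_j B i j by rewrite sumr_ge0.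
  have bM : \sum_j B i j <= (n + n)%:R * M.
    by rewrite -card_sum ler_sum // => j _; case/andP: (zB i j).
  by rewrite ler_norml; apply/andP; split; lra.
- move=> r yr i; rewrite -yeq (le_trans (ler_norm_sum _ _ _)) //.
  have r0 : 0 <= r by apply: le_trans (yr i).
  rewrite mulrDl mul1r -[leLHS]addr0 lerD // -mulrA -card_sum ler_sum // => j _.
  rewrite normrM ger0_norm //; have /andP[_ BM] := zB i j.
  rewrite -[2 * M]mulrC -mulrA ler_pM // (le_trans (ler_normD _ _)) //.
  by have := yr i; have := yr j; lra.
Qed.

(** Inserting |y|^2 <= c q into [g_step_le] makes every term a multiple of q; the last hypothesis is
    the sufficient decrease condition divided by a q. *)
Lemma step_ok_of_bounds (R : realType) (n : nat) (A : 'M[R]_n) (eps beta a c r D : R)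
    (z : 'cV[R]_(n + n)) :
  nonneg_mx A -> total_support A -> pos_vec z -> 0 < c -> 0 < a ->
  (forall i, `|LB_y A z i 0| <= r) ->
  (forall i, `|\sum_j LB_B A z i j - 1| <= D) ->
  \sum_i LB_y A z i 0 ^+ 2 <=
    c * \sum_i LB_y A z i 0 * (\sum_j LB_B A z i j - 1) ->
  0 <= r -> 0 <= D -> a * r <= 2^-1 -> a * r <= 1 - eps ->
  a / 2 + c * (a / 2 * D + a ^+ 2 * r) <= 1 - beta ->
  step_ok A eps beta z a.
Proof.
move=> A0 Ats z0 c0 a0 yr bD y2 r0 D0 ar ar' abeta; split=> [ym|].
  rewrite mulrC ler_pdivlMr // (le_trans _ ar') // ler_wpM2l ?(ltW a0) //.
  by apply: bigmax_le => // i _; apply: le_trans (yr i); exact: ler_norm.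
have [yeq _] := LB_y_spec A0 Ats z0.
rewrite grad_LB_u //.
apply: le_trans (g_step_le z0 yeq (ltW a0) ar yr bD) _.
set q := \sum_i _ * _ in y2 *.
have q0 : 0 <= q.
  by rewrite -(pmulr_rge0 _ c0) (le_trans _ y2) // sumr_ge0 // => i _; exact: sqr_ge0.
have p1 : 0 <= a ^+ 2 / 2 * D + a ^+ 3 * r.
  by rewrite addr_ge0 // !mulr_ge0 // ?exprn_ge0 // ltW.
have := ler_wpM2l p1 y2.
have : 0 <= a * q * (1 - beta - (a / 2 + c * (a / 2 * D + a ^+ 2 * r))).
  by apply: mulr_ge0; [rewrite mulr_ge0 // ltW|rewrite subr_ge0].
lra.
Qed.

Lemma small_steps_ok (R : realType) (n : nat) (A : 'M[R]_n) (eps beta G : R) :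
  nonneg_mx A -> total_support A -> eps < 1 -> beta < 1 ->
  exists2 a0 : R, 0 < a0 <= 1 & forall z a, pos_vec z -> g A z <= G ->
    0 < a <= a0 -> step_ok A eps beta z a.
Proof.
move=> A0 Ats eps1 beta1; have [c [M [c0 M0 est]]] := LB_uniform_estimates G A0 Ats.
(* A bound on |y|: Young's inequality in |y|^2 <= c q gives |y|^2 <= 2n (c M)^2, and 2n <= (2n +
   1)^2 avoids a square root. *)
pose r := c * (n + n).+1%:R * M.
have r0 : 0 <= r by rewrite !mulr_ge0 // ltW.
(* For 0 < a <= 1, a k1 <= 1 is the safeguard condition and a k2 <= 1 implies the decrease
   condition, as a^2 <= a; the threshold 1/K enforces both and a r <= 1/2. *)
pose k1 := r / (1 - eps); pose k2 := (2^-1 + c * (M / 2 + r)) / (1 - beta).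
have k10 : 0 <= k1 by rewrite divr_ge0 //; lra.
have cMr : 0 <= c * (M / 2 + r) by rewrite mulr_ge0 ?(ltW c0) //; lra.
have k20 : 0 <= k2 by rewrite divr_ge0 //; lra.
pose K := 1 + 2 * r + k1 + k2.
have K1 : 1 <= K by rewrite /K; lra.
exists K^-1; first by rewrite invr_gt0 invf_le1 ?K1 ?andbT; lra.
move=> z a z0 gz /andP[a0 aK]; have [y2 bM _] := est z z0 gz.
have {}aK : a * K <= 1 by rewrite -ler_pdivlMr ?div1r //; lra.
have aP t : 0 <= t -> t <= K -> a * t <= 1.
  by move=> t0 tK; apply: le_trans aK; rewrite ler_wpM2l // ltW.
have a1 : a <= 1 by rewrite -[a]mulr1 aP.
have yr i : `|LB_y A z i 0| <= r.
  rewrite -ler_sqr ?nnegrE // real_normK ?num_real //.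
  set y := LB_y A z in y2 *; set b := fun i => \sum_j LB_B A z i j - 1.
  have y_le : y i 0 ^+ 2 <= \sum_i y i 0 ^+ 2.
    by rewrite (bigD1 i) //= lerDl sumr_ge0 // => j _; exact: sqr_ge0.
  have cq_le : c * \sum_i y i 0 * b i <=
      \sum_i y i 0 ^+ 2 / 2 + \sum_(i < n + n) (c * M) ^+ 2 / 2.
    rewrite mulr_sumr -big_split ler_sum // => j _ /=.
    have : (c * b j) ^+ 2 <= (c * M) ^+ 2.
      rewrite -[leLHS]real_normK ?num_real //.
      rewrite ler_sqr ?nnegrE //; last by rewrite mulr_ge0 ?(ltW c0) ?(ltW M0).
      by rewrite normrM gtr0_norm // ler_pM2l //; exact: bM.
    by have := sqr_ge0 (y j 0 - c * b j); lra.
  rewrite -mulr_suml sumr_const card_ord in cq_le.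
  have : (c * M) ^+ 2 *+ (n + n) <= r ^+ 2.
    have -> : r ^+ 2 = (c * M) ^+ 2 * (n + n).+1%:R ^+ 2 by rewrite /r; ring.
    rewrite -mulr_natr ler_wpM2l ?sqr_ge0 // -natrX ler_nat.
    by apply: leq_trans (leqnSn _) _; rewrite -mulnn leq_pmulr.
  have : (c * M) ^+ 2 / 2 *+ (n + n) = (c * M) ^+ 2 *+ (n + n) / 2 by rewrite mulrnAl.
  rewrite -/(b _) in y2.
  lra.
apply: (step_ok_of_bounds A0 Ats z0 c0 a0 yr bM y2 r0 (ltW M0)).
- have := aP (2 * r) ltac:(lra) ltac:(rewrite /K; lra); lra.
- have := aP k1 k10 ltac:(rewrite /K; lra).
  by rewrite /k1 mulrA ler_pdivrMr ?mul1r //; lra.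
- have := aP k2 k20 ltac:(rewrite /K; lra).
  rewrite /k2 mulrA ler_pdivrMr ?mul1r; last lra.
  apply: le_trans.
  have : 0 <= c * r * a * (1 - a).
    by rewrite (mulr_ge0 (mulr_ge0 (mulr_ge0 (ltW c0) r0) (ltW a0))) // subr_ge0.
  lra.
Qed.

Lemma unit_step_ok (R : realType) (n : nat) (A : 'M[R]_n) (eps beta G : R) :
  nonneg_mx A -> total_support A -> 0 < eps < 1 -> 0 < beta < 2^-1 ->
  exists2 delta : R, 0 < delta & forall z, pos_vec z -> g A z <= G ->
    \sum_i LB_y A z i 0 * (\sum_j LB_B A z i j - 1) <= delta ->
    step_ok A eps beta z 1.
Proof.
move=> A0 Ats /andP[eps0 eps1] /andP[beta0 beta1].
have [c [M [c0 M0 est]]] := LB_uniform_estimates G A0 Ats.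
(* At a = 1 and D = M r the decrease condition reads r c (M/2 + 1) <= 1/2 - beta, solvable with r >
   0 because beta < 1/2. The factor 1 - eps secures the safeguard. *)
pose d := 1 + c * (M / 2 + 1); pose r := (2^-1 - beta) * (1 - eps) / d.
have cM : 0 < c * (M / 2 + 1) by rewrite mulr_gt0 //; lra.
have d1 : 1 <= d by rewrite /d; lra.
have r0 : 0 < r by rewrite divr_gt0 ?mulr_gt0 //; lra.
have rd : r * d = (2^-1 - beta) * (1 - eps) by rewrite /r divfK // gt_eqF; lra.
have rc0 : 0 <= r * (c * (M / 2 + 1)) by rewrite mulr_ge0 // ltW.
have rdE : r + r * (c * (M / 2 + 1)) = (2^-1 - beta) * (1 - eps).
  by rewrite -rd /d; ring.
have lt1 : (2^-1 - beta) * (1 - eps) <= 2^-1 - beta.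
  by rewrite ler_piMr; lra.
have lt2 : (2^-1 - beta) * (1 - eps) <= 1 - eps by rewrite ler_piMl; lra.
(* Chosen so that q <= delta gives |y|^2 <= c q <= r^2. *)
exists (r ^+ 2 / c); first by rewrite divr_gt0 // exprn_gt0.
move=> z z0 gz; have [y2 _ bM] := est z z0 gz.
set q := \sum_i _ => qd.
have yr i : `|LB_y A z i 0| <= r.
  rewrite -ler_sqr ?nnegrE ?(ltW r0) // real_normK ?num_real //.
  move: qd; rewrite ler_pdivlMr // mulrC; apply: le_trans.
  apply: le_trans y2.
  by rewrite (bigD1 i) //= lerDl sumr_ge0 // => j _; exact: sqr_ge0.
have Mr0 : 0 <= M * r by rewrite mulr_ge0 ?ltW.
apply: (step_ok_of_bounds A0 Ats z0 c0 ltr01 yr (bM r yr) y2 (ltW r0) Mr0); lra.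
Qed.

(** * Convergence and eventual unit steps *)

(** From some [K] on, the monotone sequence stays within [e] of its infimum. *)
Lemma bounded_decrease (R : realType) (u : nat -> R) (lb e : R) :
  0 < e -> (forall k, lb <= u k) -> (forall k, u k.+1 <= u k) ->
  exists K, forall k, (K <= k)%N -> u k - u k.+1 < e.
Proof.
move=> e0 ulb udec.
have uinf : has_inf (range u).
  by split; [exists (u 0%N), 0%N | exists lb => _ [k _ <-]].
have [_ [K _ <-] uK] := inf_adherent e0 uinf.
exists K => k Kk; rewrite ltrBlDr (le_lt_trans (y := u K)) //.
  elim: k Kk => [|k IH]; first by rewrite leqn0 => /eqP->.
  by rewrite leq_eqVlt => /predU1P[->//|/IH]; exact: le_trans.
rewrite (lt_le_trans uK) // addrC lerD2l; apply: ge_inf; first exact: uinf.2.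
by exists k.+1.
Qed.

Unset Implicit Arguments.

Theorem theorem3 (R : realType) (n : nat) (A : 'M[R]_n)
    (A_ge0 : nonneg_mx A) (A_ts : total_support A)
    (eps beta tau : R)
    (eps01 : 0 < eps < 1) (beta_half : 0 < beta < 2^-1) (tau01 : 0 < tau < 1)
    (zeta : nat -> 'cV[R]_(n + n)) (alpha : nat -> R)
    (zeta1_gt0 : pos_vec (zeta 1%N))
    (LB : LB_iteration A eps beta tau zeta alpha) :
  exists K : nat, forall k, (K <= k)%N -> alpha k = 1.
Proof.
have [[lb glb] _] := sublevel_bounds A_ge0 A_ts.
pose G := g A (zeta 1%N).
have [/andP[tau0 tau1] /andP[beta0 beta1]] := (tau01, beta_half).
pose q z := \sum_i LB_y A z i 0 * (\sum_j LB_B A z i j - 1).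
have [c [M [c0 _ est]]] := LB_uniform_estimates G A_ge0 A_ts.
have q_ge0 z : pos_vec z -> g A z <= G -> 0 <= q z.
  move=> z0 gz; have [y2 _ _] := est z z0 gz.
  by rewrite -(pmulr_rge0 _ c0) (le_trans _ y2) // sumr_ge0 // => i _; exact: sqr_ge0.
have [a0 /andP[a0_gt0 a0_le1] small] : exists2 a0 : R, 0 < a0 <= 1 &
    forall z a, pos_vec z -> g A z <= G -> 0 < a <= a0 -> step_ok A eps beta z a.
  by apply: small_steps_ok => //; [case/andP: eps01|lra].
have [delta delta0 unit_ok] := unit_step_ok G A_ge0 A_ts eps01 beta_half.
have step k : (1 <= k)%N -> pos_vec (zeta k) -> [/\ 0 < alpha k,
    pos_vec (zeta k.+1) &
    g A (zeta k.+1) <= g A (zeta k) - beta * alpha k * q (zeta k)].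
  move=> k1 zk0; have [[m [-> ok _]] ->] := LB k k1.
  have tm0 : 0 < tau ^+ m by rewrite exprn_gt0.
  split=> //; first exact: step_ok_pos eps01 (ltW tm0) zk0 ok.
  by apply: le_trans ok.2 _; rewrite grad_LB_u // mulrN.
(* Positivity and the sublevel bound go through one induction, since q >= 0 is available only where
   both hold. The shift matches the start of the iteration at 1. *)
have inv k : pos_vec (zeta k.+1) /\ g A (zeta k.+1) <= G.
  elim: k => [|k [zk0 gk]]; first by split.
  have [a_gt0 zk1 dec] := step k.+1 isT zk0; split=> //.
  apply: le_trans dec _; rewrite lerBlDr (le_trans gk) // lerDl.
  by rewrite !mulr_ge0 ?q_ge0 // ltW.
(* Either the step is 1, or the preceding trial step was rejected and so exceeds [a0]. *)
have alpha_ge k : tau * a0 <= alpha k.+1.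
  have [zk0 gk] := inv k; have [[[|m] [-> _ nok]] _] := LB k.+1 isT.
    by rewrite expr0; apply: mulr_ile1 => //; exact: ltW.
  rewrite exprS ler_pM2l // ltW // ltNge; apply/negP => tm.
  by apply: (nok m (ltnSn m)); apply: small => //; rewrite exprn_gt0.
(* A step with q > delta would lower [g] by at least this amount, which is impossible for large
   k. *)
have e0 : 0 < beta * (tau * a0) * delta by rewrite !mulr_gt0.
have gdec k : g A (zeta k.+2) <= g A (zeta k.+1).
  have [zk0 gk] := inv k; have [a_gt0 _ dec] := step k.+1 isT zk0.
  apply: le_trans dec _; rewrite lerBlDr lerDl.
  by rewrite !mulr_ge0 ?q_ge0 // ltW.
have [K KP] := bounded_decrease (u := fun k => g A (zeta k.+1)) e0
  (fun k => glb _ (inv k).1) gdec.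
exists K.+1 => -[//|k] Kk; have [zk0 gk] := inv k.
have qk0 := q_ge0 _ zk0 gk.
have ok1 : step_ok A eps beta (zeta k.+1) 1.
  apply: unit_ok => //; rewrite -/(q _) leNgt; apply/negP => q_gt.
  have [_ _ dec] := step k.+1 isT zk0.
  have := KP _ Kk; apply/negP; rewrite -leNgt lerBrDr -lerBrDl.
  apply: le_trans dec _; rewrite lerD2l lerN2.
  apply: ler_pM; [|exact: ltW|by rewrite ler_pM2l|exact: ltW].
  by rewrite !mulr_ge0 // ltW.
(* Backtracking tries 1 first, so its acceptance excludes any positive exponent. *)
have [[[|m] [-> _ nok]] _] := LB k.+1 isT; first by rewrite expr0.
by have := nok 0%N isT; rewrite expr0.
Qed.
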